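(* For each $k=1,\ldots,K$ suppose that there exists $0\le \rho_m^k\in\mathbb{R}$ with $\boldsymbol{f}^k(\cdot,\cdot,\rho_m^k,\cdot)=0$ and $\rho_m^k\le\rho_0^k$. Set $\mathcal{I}_k=[\rho_m^k,\infty)$ or, if in addition there exists $\rho_M^k\in\mathbb{R}$ with $\boldsymbol{f}^k(\cdot,\cdot,\rho_M^k,\cdot)=0$ and $\rho_0^k\le\rho_M^k$, set $\mathcal{I}_k=[\rho_m^k,\rho_M^k]$. Let the numerical flux functions $F_1^k,F_2^k$ be monotone-based numerical fluxes, and let the cell averages $\overline{\rho}^{k,n}_{i,j}$ be computed from the initial cell averages $\overline{\rho}^{k,0}_{i,j}$ by solving the semi-discrete scheme $\partial_t\overline{\boldsymbol\rho}=\mathcal{L}(\overline{\boldsymbol\rho})$ equipped with the linear scaling limiter (all described in the context) by a strong stability preserving (SSP) Runge–Kutta method with nonnegative coefficients, CFL restriction factor $C_{\mathrm{SSP}}$ and step size $\Delta t>0$. Assume the CFL condition $$\lambda_1a_1+\lambda_2a_2\le\frac{C_{\mathrm{SSP}}}{6},\qquad \lambda_1=\frac{\Delta t}{\Delta x_1},\quad \lambda_2=\frac{\Delta t}{\Delta x_2},\quad a_1=L_{1,1}+L_{1,2},\quad a_2=L_{2,1}+L_{2,2},$$ where $L_{\ell_1,\ell_2}$ is the Lipschitz constant of the numerical fluxes in the $x_{\ell_1}$-direction with respect to their $\ell_2$-th variable. Then $$\overline{\rho}^{k,n}_{i,j}\in\mathcal{I}_k\qquad\text{for all } i,j\in\mathbb{Z},\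 n\in\mathbb{N},\ k=1,\ldots,K.$$
   Context: **Equation.** Consider the system of nonlocal conservation laws $$\partial_t\rho^k+\mathrm{div}_{\mathbf{x}}\,\boldsymbol{f}^k(t,\mathbf{x},\rho^k,\boldsymbol\eta*\boldsymbol\rho)=0,\quad (t,\mathbf{x})\in\mathbb{R}^+\times\mathbb{R}^2,\ k=1,\ldots,K,\qquad \boldsymbol\rho(0,\cdot)=\boldsymbol\rho_0,$$ with $\boldsymbol\rho=(\rho^1,\ldots,\rho^K)$, fluxes $\boldsymbol f^k=(f_1^k,f_2^k):\mathbb{R}^+\times\mathbb{R}^2\times\mathbb{R}\times\mathbb{R}^M\to\mathbb{R}^2$, kernel $\boldsymbol\eta=(\eta^{m,k})\in(\mathbf{C}^2\cap\mathbf{W}^{2,\infty}\cap L^1)(\mathbb{R}^2;\mathbb{R}^{M\times K})$ and $(\boldsymbol\eta*\boldsymbol\rho)_m(t,\mathbf{x})=\int_{\mathbb{R}^2}\sum_{k=1}^K\eta^{m,k}(\mathbf{x}-\tilde{\mathbf{x}})\rho^k(t,\tilde{\mathbf{x}})\,d\tilde{\mathbf{x}}$ for $m=1,\ldots,M$. The initial data and fluxes satisfy standard regularity assumptions, so that all quantities below (in particular initial cell averages and the sums defining the discrete nonlocal terms) are well defined. **Grid.** For $\Delta x_1,\Delta x_2>0$ and real indices $a,b$ write $\mathbf{x}^{a,b}=(a\Delta x_1,b\Delta x_2)$. For $i,j\in\mathbb{Z}$ the cell is $C_{i,j}=[(i-\frac12)\Delta x_1,(i+\frac12)\Delta x_1)\times[(j-\frac12)\Delta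 x_2,(j+\frac12)\Delta x_2)$. Put $\gamma=\frac{1}{2\sqrt3}$ (so that $\pm\gamma$ are the two-point Gauss–Legendre nodes on $[-\frac12,\frac12]$) and $t^n=n\Delta t$. Initial cell averages: $\overline\rho_{i,j}^{k,0}=\frac{1}{\Delta x_1\Delta x_2}\int_{C_{i,j}}\rho_0^k(\mathbf{x})\,d\mathbf{x}$. **Reconstruction.** Given cell averages $\overline\rho^{k,n}_{i,j}$, the (third-order CWENO) reconstruction provides for each $k$ and each cell a polynomial $P^{k,n}_{i,j}$ in two variables of total degree at most $2$ whose average over $C_{i,j}$ equals $\overline\rho^{k,n}_{i,j}$. Only these two properties are relevant here; any choice of reconstruction with them is allowed. **Linear scaling limiter.** Each $P^{k,n}_{i,j}$ is replaced, everywhere in the scheme, by $$\widetilde P^{k,n}_{i,j}(\mathbf{x})=\overline\rho^{k,n}_{i,j}+\theta\,\bigl(P^{k,n}_{i,j}(\mathbf{x})-\overline\rho^{k,n}_{i,j}\bigr),\qquad \theta=\min\left\{\left|\frac{\sup\mathcal{I}_k-\overline\rho^{k,n}_{i,j}}{M^{k,n}_{i,j}-\overline\rho^{k,n}_{i,j}}\right|,\left|\frac{\inf\mathcal{I}_k-\overline\rho^{k,n}_{i,j}}{m^{k,n}_{i,j}-\overline\rho^{k,n}_{i,j}}\right|,1\right\},$$ where $M^{k,n}_{i,j}$ and $m^{k,n}_{i,j}$ are the maximum and minimum of $P^{k,n}_{i,j}$ over the closure of $C_{i,j}$; a quotient with zero denominator or with $\sup\mathcal{I}_k=\infty$ is taken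 to be $+\infty$. Below, $P^{k,n}_{i,j}$ denotes these limited polynomials. **Discrete nonlocal term.** For a point $\mathbf{y}=\mathbf{x}^{a,b}$ on a cell interface, $\mathbf{R}^n_{a,b}\in\mathbb{R}^M$ has components $$(\mathbf{R}^n_{a,b})_m=\sum_{k=1}^K\frac{\Delta x_1\Delta x_2}{4}\sum_{p,q\in\mathbb{Z}}\ \sum_{s,s'\in\{-1,1\}}\eta^{m,k}\bigl(\mathbf{y}-\mathbf{x}^{p+s\gamma,\,q+s'\gamma}\bigr)\,P^{k,n}_{p,q}\bigl(\mathbf{x}^{p+s\gamma,\,q+s'\gamma}\bigr)$$ (composite tensor-product two-point Gauss quadrature). **Monotone-based numerical fluxes.** For $\ell=1,2$ and each $k$, $F_\ell^k(u,v;t,\mathbf{x},\mathbf{R})$ is defined for $u,v\in\mathcal{I}_k$, $(t,\mathbf{x},\mathbf{R})\in\mathbb{R}^+\times\mathbb{R}^2\times\mathbb{R}^M$, and for every fixed $(t,\mathbf{x},\mathbf{R})$ it is consistent, $F_\ell^k(u,u;t,\mathbf{x},\mathbf{R})=f_\ell^k(t,\mathbf{x},u,\mathbf{R})$; monotone, i.e. nondecreasing in $u$ and nonincreasing in $v$; and Lipschitz continuous in $u$ with constant $L_{\ell,1}$ and in $v$ with constant $L_{\ell,2}$, these constants being uniform in $k$ and $(t,\mathbf{x},\mathbf{R})$. Write $F_{\ell,k,n}^{a,b}(u,v)=F_\ell^k(u,v;t^n,\mathbf{x}^{a,b},\mathbf{R}^n_{a,b})$. **Semi-discrete scheme.** The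 operator $\mathcal{L}$, evaluated at time $t^n$ on the cell averages $\overline{\boldsymbol\rho}^{\,n}$, has components $$\begin{aligned}\mathcal{L}(\overline{\boldsymbol\rho}^{\,n})^k_{i,j}=-\sum_{\xi\in\{-1,1\}}\Bigl[&\tfrac{1}{2\Delta x_1}\Bigl(F_{1,k,n}^{i+\frac12,j+\xi\gamma}\bigl(P^{k,n}_{i,j}(\mathbf{x}^{i+\frac12,j+\xi\gamma}),P^{k,n}_{i+1,j}(\mathbf{x}^{i+\frac12,j+\xi\gamma})\bigr)\\&\quad-F_{1,k,n}^{i-\frac12,j+\xi\gamma}\bigl(P^{k,n}_{i-1,j}(\mathbf{x}^{i-\frac12,j+\xi\gamma}),P^{k,n}_{i,j}(\mathbf{x}^{i-\frac12,j+\xi\gamma})\bigr)\Bigr)\\+&\tfrac{1}{2\Delta x_2}\Bigl(F_{2,k,n}^{i+\xi\gamma,j+\frac12}\bigl(P^{k,n}_{i,j}(\mathbf{x}^{i+\xi\gamma,j+\frac12}),P^{k,n}_{i,j+1}(\mathbf{x}^{i+\xi\gamma,j+\frac12})\bigr)\\&\quad-F_{2,k,n}^{i+\xi\gamma,j-\frac12}\bigl(P^{k,n}_{i,j-1}(\mathbf{x}^{i+\xi\gamma,j-\frac12}),P^{k,n}_{i,j}(\mathbf{x}^{i+\xi\gamma,j-\frac12})\bigr)\Bigr)\Bigr].\end{aligned}$$ The same definition is used at intermediate stages, with the stage values in place of $\overline{\boldsymbol\rho}^{\,n}$ (reconstruction, limiter and nonlocal terms recomputed from them) and the corresponding stage time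 in place of $t^n$. **SSP Runge–Kutta methods.** An SSP (possibly multistep) Runge–Kutta method with nonnegative coefficients is an explicit method in which every stage value, including the final one $\overline{\boldsymbol\rho}^{\,n+1}$, has the form $\sum_{r}\alpha_r\bigl(u^{(r)}+\frac{\beta_r}{\alpha_r}\Delta t\,\mathcal{L}(u^{(r)})\bigr)$ with $\alpha_r>0$, $\beta_r\ge0$, $\sum_r\alpha_r=1$ (coefficients depending on the stage), where each $u^{(r)}$ is an earlier stage value or the solution at the current or a previous time level. Its CFL restriction factor is $C_{\mathrm{SSP}}=\min\alpha_r/\beta_r$, the minimum being over all stages and all $r$ with $\beta_r>0$. Example: the six-step method $\rho^{n+1}=\frac{108}{125}\bigl(\rho^n+\frac53\Delta t\,\mathcal{L}(\rho^n)\bigr)+\frac{17}{125}\bigl(\rho^{n-5}+\frac{30}{17}\Delta t\,\mathcal{L}(\rho^{n-5})\bigr)$ with $C_{\mathrm{SSP}}\approx0.57$. For a multistep method the additional starting values are understood to have values in $\mathcal{I}_k$ (e.g. computed by a one-step SSP Runge–Kutta method satisfying the corresponding CFL condition). *)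

(* Defs.v *)
From HB Require Import structures.
From mathcomp Require Import all_boot all_order all_algebra.
From mathcomp Require Import all_classical all_reals all_analysis.
Import Order.TTheory GRing.Theory Num.Theory.
Import numFieldNormedType.Exports.

Set Implicit Arguments.
Unset Strict Implicit.
Unset Printing Implicit Defensive.

Local Open Scope classical_set_scope.
Local Open Scope ring_scope.

Section Plane.
Context {R : realType}.

Definition lebesgue2 := (@lebesgue_measure R \x @lebesgue_measure R)%E.

(* Partial derivatives are derivatives along the two basis vectors. *)
Definition basis2 (e : R * R) := e = (1, 0) \/ e = (0, 1).

Definition C1 (g : R * R -> R) :=
  continuous g /\
  forall e, basis2 e -> (forall x, derivable g x e) /\ continuous ('D_e g).

Definition C2 (g : R * R -> R) :=
  C1 g /\ forall e, basis2 e -> C1 ('D_e g).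

Definition Linfty (g : R * R -> R) := finite_norm lebesgue2 +oo%E g.

(* Meant for C^2 functions, whose weak derivatives are the classical ones. *)
Definition W2infty (g : R * R -> R) :=
  Linfty g /\
  forall e, basis2 e ->
    Linfty ('D_e g) /\ forall e', basis2 e' -> Linfty ('D_e' ('D_e g)).

Definition regular_kernel (g : R * R -> R) :=
  [/\ C2 g, W2infty g & lebesgue2.-integrable setT (EFin \o g)].

Definition polynomial_of_degree_le (d : nat) (P : R * R -> R) :=
  exists c : nat -> nat -> R, forall x,
    P x = \sum_(p < d.+1) \sum_(q < d.+1 | (p + q <= d)%N)
            c p q * x.1 ^+ p * x.2 ^+ q.

(* Unordered sums over Z^2; [sumZ2 g] is meaningful when [summableZ2 g]. *)
Definition summableZ2 (g : int * int -> R) :=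
  (summable setT (EFin \o g) : Prop).

Definition sumZ2 (g : int * int -> R) : R :=
  fine (\esum_(x in setT) (EFin \o g)^\+ x
        - \esum_(x in setT) (EFin \o g)^\- x)%E.

End Plane.

Section Grid.
Context {R : realType} (dx1 dx2 : R).

(* Positive Gauss-Legendre node of the two-point rule on [-1/2, 1/2]. *)
Definition gauss_node : R := (2 * Num.sqrt 3)^-1.

Definition one_half : R := 2^-1.

Definition pm1 : seq R := [:: -1; 1].

Definition grid_point (a b : R) : R * R := (a * dx1, b * dx2).

Definition on_interface (a b : R) :=
  exists i : int, a = i%:~R + one_half \/ b = i%:~R + one_half.

Definition cell (i j : int) : set (R * R) :=
  `[(i%:~R - one_half) * dx1, (i%:~R + one_half) * dx1[
  `*` `[(j%:~R - one_half) * dx2, (j%:~R + one_half) * dx2[.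

Definition cell_average (g : R * R -> R) (i j : int) : R :=
  (dx1 * dx2)^-1 * \int[lebesgue2]_(x in cell i j) g x.

End Grid.

(* Cell averages of all components on the whole grid. *)
Definition state (R : realType) (K : nat) := 'I_K -> int -> int -> R.

(* One polynomial function on the plane for each component and each cell. *)
Definition reconstruction (R : realType) (K : nat) :=
  'I_K -> int -> int -> R * R -> R.

Section Scheme.
Context {R : realType} {K M : nat} (dx1 dx2 : R).

Definition is_reconstruction_operator
    (rec : state R K -> reconstruction R K) :=
  forall v k i j,
    polynomial_of_degree_le 2 (rec v k i j) /\
    cell_average dx1 dx2 (rec v k i j) i j = v k i j.

(* |(s - a) / (d - a)|, with the value +oo when d = a or s = +oo. *)
Definition limiter_quotient (s : \bar R) (a d : R) : \bar R :=
  if (d - a == 0) || (s == +oo%E) then +oo%E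
  else (`|(fine s - a) / (d - a)|)%:E.

(* [a] is the average of P over the cell C; suprema and infima of I are taken
   in the extended reals. The maximum and minimum of P over the compact closure
   of C are written as a supremum and an infimum. *)
Definition limiter_theta (I : set R) (C : set (R * R))
    (a : R) (P : R * R -> R) : R :=
  let Pmax := sup [set P x | x in closure C] in
  let Pmin := inf [set P x | x in closure C] in
  fine (Order.min
          (Order.min (limiter_quotient (ereal_sup (EFin @` I)) a Pmax)
                     (limiter_quotient (ereal_inf (EFin @` I)) a Pmin))
          1%E).

Definition limited_reconstruction (I : 'I_K -> set R)
    (rec : state R K -> reconstruction R K) (v : state R K) :
    reconstruction R K :=
  fun k i j x =>
    let P := rec v k i j in
    v k i j + limiter_theta (I k) (cell dx1 dx2 i j) (v k i j) P
              * (P x - v k i j).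

Definition quadrature_cell (eta : 'I_M -> 'I_K -> R * R -> R)
    (P : reconstruction R K) (y : R * R) (m : 'I_M) (k : 'I_K)
    (c : int * int) : R :=
  \sum_(s <- pm1) \sum_(s' <- pm1)
    let z := grid_point dx1 dx2 (c.1%:~R + s * gauss_node) (c.2%:~R + s' * gauss_node) in
    eta m k (y - z) * P k c.1 c.2 z.

Definition nonlocal_well_defined (eta : 'I_M -> 'I_K -> R * R -> R)
    (P : reconstruction R K) :=
  forall a b, on_interface a b -> forall m k,
    summableZ2 (quadrature_cell eta P (grid_point dx1 dx2 a b) m k).

Definition nonlocal (eta : 'I_M -> 'I_K -> R * R -> R)
    (P : reconstruction R K) (a b : R) : 'rV[R]_M :=
  \row_m \sum_(k < K) dx1 * dx2 / 4 *
    sumZ2 (quadrature_cell eta P (grid_point dx1 dx2 a b) m k).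

(* [F u v t x r] is the numerical flux, [fl t x u r] the exact flux, both in
   one coordinate direction and for one component. *)
Record monotone_based_flux (I : set R) (fl : R -> R * R -> R -> 'rV[R]_M -> R)
    (F : R -> R -> R -> R * R -> 'rV[R]_M -> R) (L1 L2 : R) : Prop := {
  flux_consistent : forall t x r u, 0 <= t -> I u ->
    F u u t x r = fl t x u r;
  flux_nondecreasing : forall t x r u u' v, 0 <= t -> I u -> I u' -> I v ->
    u <= u' -> F u v t x r <= F u' v t x r;
  flux_nonincreasing : forall t x r u v v', 0 <= t -> I u -> I v -> I v' ->
    v <= v' -> F u v' t x r <= F u v t x r;
  flux_lipschitz_ge0 : 0 <= L1 /\ 0 <= L2;
  flux_lipschitz1 : forall t x r u u' v, 0 <= t -> I u -> I u' -> I v ->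
    `|F u v t x r - F u' v t x r| <= L1 * `|u - u'|;
  flux_lipschitz2 : forall t x r u v v', 0 <= t -> I u -> I v -> I v' ->
    `|F u v t x r - F u v' t x r| <= L2 * `|v - v'| }.

Definition semidiscrete_operator (eta : 'I_M -> 'I_K -> R * R -> R)
    (F1 F2 : 'I_K -> R -> R -> R -> R * R -> 'rV[R]_M -> R)
    (P : reconstruction R K) (t : R) : state R K :=
  fun k i j =>
    let x := grid_point dx1 dx2 in
    let G F (a b u v : R) : R := F k u v t (x a b) (nonlocal eta P a b) in
    let ir : R := i%:~R in
    let jr : R := j%:~R in
    - \sum_(xi <- pm1)
       ((2 * dx1)^-1 *
          (G F1 (ir + one_half) (jr + xi * gauss_node)
             (P k i j (x (ir + one_half) (jr + xi * gauss_node)))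
             (P k (i + 1) j (x (ir + one_half) (jr + xi * gauss_node)))
           - G F1 (ir - one_half) (jr + xi * gauss_node)
             (P k (i - 1) j (x (ir - one_half) (jr + xi * gauss_node)))
             (P k i j (x (ir - one_half) (jr + xi * gauss_node))))
        + (2 * dx2)^-1 *
          (G F2 (ir + xi * gauss_node) (jr + one_half)
             (P k i j (x (ir + xi * gauss_node) (jr + one_half)))
             (P k i (j + 1) (x (ir + xi * gauss_node) (jr + one_half)))
           - G F2 (ir + xi * gauss_node) (jr - one_half)
             (P k i (j - 1) (x (ir + xi * gauss_node) (jr - one_half)))
             (P k i j (x (ir + xi * gauss_node) (jr - one_half))))).

End Scheme.

(* The values a stage may use: the solution at time level n - q, or the value
   of the stage with index j (counted from 0) of the current step. *)
Inductive ssp_source := Level of nat | Stage of nat.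

Record ssp_term (R : realType) := SSPTerm {
  term_source : ssp_source;
  term_alpha : R;
  term_beta : R }.

(* [ssp_depth] is the number of additional starting values (0 for a one-step
   method); the last stage is the solution at the new time level. *)
Record ssp_scheme (R : realType) := SSPScheme {
  ssp_depth : nat;
  ssp_stages : seq (seq (ssp_term R)) }.

Section SSP.
Context {R : realType} {K : nat} (m : ssp_scheme R).

Definition nstages := size (ssp_stages m).

Definition stage_terms (i : nat) : seq (ssp_term R) := nth [::] (ssp_stages m) i.

Definition source_ok (i : nat) (s : ssp_source) : bool :=
  match s with Level q => q <= ssp_depth m | Stage j => j < i end%N.

Definition ssp_valid : Prop :=
  (0 < nstages)%N /\
  forall i, (i < nstages)%N ->
    \sum_(r <- stage_terms i) term_alpha r = 1 /\
    all (fun r => [&& 0 < term_alpha r, 0 <= term_beta r &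
                      source_ok i (term_source r)]) (stage_terms i).

(* The value is +oo if all coefficients beta vanish. *)
Definition C_SSP : \bar R :=
  \big[Order.min/+oo%E]_(r <- flatten (ssp_stages m) | 0 < term_beta r)
    (term_alpha r / term_beta r)%:E.

Definition source_value T (levels : nat -> T) (stages : nat -> T) (n : nat)
    (s : ssp_source) : T :=
  match s with Level q => levels (n - q)%N | Stage j => stages j end.

(* [u n] is the solution at time level n, [w n i] and [tau n i] are the value
   and the time of stage i of the step from n to n.+1. Stage times are those
   obtained by applying the method to the additional equation t' = 1. *)
Definition ssp_solution (dt : R) (L : R -> state R K -> state R K)
    (u : nat -> state R K) (w : nat -> nat -> state R K)
    (tau : nat -> nat -> R) : Prop :=
  forall n, (ssp_depth m <= n)%N ->
    let val := source_value u (w n) n in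
    let time := source_value (fun p => p%:R * dt) (tau n) n in
    (forall i, (i < nstages)%N ->
       tau n i = \sum_(r <- stage_terms i)
         term_alpha r *
           (time (term_source r) + term_beta r / term_alpha r * dt) /\
       forall k a b,
         w n i k a b = \sum_(r <- stage_terms i)
           term_alpha r *
             (val (term_source r) k a b
              + term_beta r / term_alpha r * dt
                * L (time (term_source r)) (val (term_source r)) k a b)) /\
    u n.+1 = w n nstages.-1.

End SSP.

(* Main.v *)
Require Import Defs.
From mathcomp Require Import all_boot all_order all_algebra.
From mathcomp Require Import all_classical all_reals all_analysis.
From mathcomp Require Import measurable_realfun.
From mathcomp Require Import ring lra.
Import Order.TTheory GRing.Theory Num.Theory.
Import numFieldNormedType.Exports.

Set Implicit Arguments.
Unset Strict Implicit.
Unset Printing Implicit Defensive.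

Local Open Scope classical_set_scope.
Local Open Scope ring_scope.

(** The heart of the matter is a single forward Euler step
    [v + h * L(v)] with [6 * h * (a1 / dx1 + a2 / dx2) <= 1].

    A quadratic polynomial is integrated exactly over a cell by two tensor
    product rules: Simpson's rule in one direction times the two-point Gauss
    rule in the other ([cell_average_quadrature]).  The nodes at the ends of
    Simpson's rule are precisely the interface points at which the scheme
    evaluates its fluxes.  Hence the cell average is, in two ways, a convex
    combination of values of the reconstruction: one gives weight
    [1/12 = 1/6 * 1/2] to each interface point in the first direction, the other
    to each interface point in the second direction.  The limiter puts
    all these values into the interval [I] and leaves the average unchanged
    ([limited_reconstruction_mem], [limited_reconstruction_quadrature]).

    Let [b] be an endpoint of [I], where the flux vanishes.  Since the flux
    depends on position and on the nonlocal term, the fluxes through opposite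
    sides of a cell are not comparable with each other; but each of them can be
    compared with [F(b, b) = 0].  Monotonicity replaces the value taken from the
    neighbouring cell by [b], and Lipschitz continuity bounds what remains by
    the distance from [b] of the interface value of the cell itself
    ([flux_difference_le]).  The change towards [b] is therefore at most [a1]
    (respectively [a2]) times distances from [b] of interface values, and 1/12
    of their sum is at most the distance of the cell average from [b].  The
    step-size restriction, whose factor 6 comes from the end weights of
    Simpson's rule, then prevents the new average from crossing [b]
    ([euler_step]).

    Every stage of a strong stability preserving method is a convex combination
    of forward Euler steps whose lengths [(beta / alpha) * dt] obey the same
    restriction by the definition of the factor [C_SSP], and intervals are
    convex; so the property is inherited by induction on stages and time levels
    ([ssp_invariant]), starting from the cell averages of the initial datum. *)

(** * Moments of monomials over rectangles *)

Lemma ler_norm_endpoints (R : realDomainType) (u v x : R) :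
  u <= x <= v -> `|x| <= `|u| + `|v|.
Proof.
move=> /andP[ux xv]; rewrite ler_norml.
have := ler_norm v; have := ler_norm (- u); rewrite normrN.
have := normr_ge0 v; have := normr_ge0 u; lra.
Qed.

Lemma integral_power (R : realType) (a b : R) (n : nat) : a < b ->
  (\int[lebesgue_measure]_(x in `[a, b[) (x ^+ n)%:E =
   ((b ^+ n.+1 - a ^+ n.+1) / n.+1%:R)%:E)%E.
Proof.
move=> ab.
have dF x : derivable (fun y : R => n.+1%:R^-1 *: y ^+ n.+1) x 1.
  by apply: derivableZ; exact: exprn_derivable.
have cF : continuous (fun y : R => n.+1%:R^-1 *: y ^+ n.+1).
  by move=> x; apply/differentiable_continuous/derivable1_diffP.
rewrite integral_itv_bndo_bndc; last first.
  by apply/measurable_EFinP; apply: measurable_funTS; exact: exprn_measurable.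
rewrite (@continuous_FTC2 _ _ (fun x => n.+1%:R^-1 *: x ^+ n.+1)) //.
- by rewrite -EFinB -scalerBr [_ *: _]mulrC.
- by apply: continuous_in_subspaceT => x _; exact: exprn_continuous.
- split.
  + by move=> x _; exact: dF.
  + exact/cvg_at_right_filter/cF.
  + exact/cvg_at_left_filter/cF.
- move=> x _; rewrite derive1E deriveZ; last exact: exprn_derivable.
  rewrite exp_derive /= /GRing.scale /= mulr1 mulrA.
  by rewrite mulVf ?mul1r // pnatr_eq0.
Qed.

(** The integral of a product of two functions of separate variables over a
    rectangle factorizes, by Fubini's theorem. *)
Lemma Rintegral_setX_mul d1 d2 (T1 : measurableType d1) (T2 : measurableType d2)
    (R : realType) (m1 : {sigma_finite_measure set T1 -> \bar R})
    (m2 : {sigma_finite_measure set T2 -> \bar R})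
    (A : set T1) (B : set T2) (g : T1 -> R) (h : T2 -> R) :
  measurable A -> measurable B ->
  m1.-integrable A (EFin \o g) -> m2.-integrable B (EFin \o h) ->
  (m1 \x m2)%E.-integrable (A `*` B) (EFin \o (fun x => g x.1 * h x.2)) ->
  \int[(m1 \x m2)%E]_(x in A `*` B) (g x.1 * h x.2) =
  \int[m1]_(x in A) g x * \int[m2]_(y in B) h y.
Proof.
move=> mA mB ig ih igh.
have mAB : measurable (A `*` B) by exact: measurableX.
have gfin := integrable_fin_num mA ig.
have hfin := integrable_fin_num mB ih.
rewrite /Rintegral -fineM //; congr fine.
rewrite integral_mkcond -integral12_prod_meas1; last first.
  by apply/integrable_restrict => //; rewrite setTI.
transitivity (\int[m1]_(x in A) ((g x)%:E * \int[m2]_(y in B) (h y)%:E))%E.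
  rewrite [RHS]integral_mkcond; apply: eq_integral => x _.
  rewrite /fubini_F patchE; case: ifPn => xA; last first.
    apply: integral0_eq => y _; rewrite patchE ifF //.
    by apply/negbTE; move: xA; apply: contra; rewrite !inE => -[].
  rewrite -integralZl //  [RHS]integral_mkcond; apply: eq_integral => y _.
  rewrite !patchE (_ : (_ \in _) = (y \in B)) //.
  apply/idP/idP; rewrite !inE; first by case.
  by move=> ?; split => //; rewrite inE in xA.
by rewrite -(fineK hfin) integralZr.
Qed.

(** Lebesgue measure lives on the type [measurableTypeR R]; the casts keep the
    product sigma-algebra of the plane tied to it. *)
Lemma measurable_monomial (R : realType) (p q : nat) (D : set (R * R)) :
  measurable_fun (D : set (measurableTypeR R * measurableTypeR R))
    (fun x => x.1 ^+ p * x.2 ^+ q : R).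
Proof.
apply: measurable_funTS; apply: measurable_funM.
  by apply: measurable_funX; exact: measurable_fst.
by apply: measurable_funX; exact: measurable_snd.
Qed.

Section Rectangle.
Context {R : realType}.
Variables (a b c d : R).
Hypotheses (ab : a < b) (cd : c < d).

Let C : set (R * R) := `[a, b[ `*` `[c, d[.

Lemma measurable_rectangle :
  measurable (C : set (measurableTypeR R * measurableTypeR R)).
Proof. by apply: measurableX. Qed.

Lemma lebesgue2_rectangle : lebesgue2 C = ((b - a) * (d - c))%:E.
Proof.
rewrite /lebesgue2 product_measure1E //= !lebesgue_measure_itv /=.
by rewrite !lte_fin ab cd -!EFinD -EFinM.
Qed.

Lemma integrable_monomial (p q : nat) :
  lebesgue2.-integrable C (EFin \o (fun x => x.1 ^+ p * x.2 ^+ q)).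
Proof.
apply: measurable_bounded_integrable.
- exact: measurable_rectangle.
- by have := ltry ((b - a) * (d - c)); rewrite -lebesgue2_rectangle.
- exact: measurable_monomial.
- pose B (u v : R) : R := `|u| + `|v|.
  have bnd (u v x : R) : x \in `[u, v[ -> `|x| <= B u v.
    rewrite in_itv /= => /andP[ux /ltW xv].
    by apply: ler_norm_endpoints; rewrite ux xv.
  exists (B a b ^+ p * B c d ^+ q); split; first exact: num_real.
  move=> M BM [x y] /= [xab ycd]; apply: le_trans (ltW BM).
  rewrite normrM !normrX; apply: ler_pM; rewrite ?exprn_ge0 //.
    by apply: lerXn2r; rewrite ?nnegrE ?bnd ?addr_ge0.
  by apply: lerXn2r; rewrite ?nnegrE ?bnd ?addr_ge0.
Qed.

Lemma Rintegral_monomial (p q : nat) :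
  \int[lebesgue2]_(x in C) (x.1 ^+ p * x.2 ^+ q) =
  (b ^+ p.+1 - a ^+ p.+1) / p.+1%:R * ((d ^+ q.+1 - c ^+ q.+1) / q.+1%:R).
Proof.
have integrable_power (u v : R) n :
    lebesgue_measure.-integrable `[u, v[ (EFin \o (fun x : R => x ^+ n)).
  have itv_sub : [set` `[u, v[] `<=` ([set` `[u, v]] : set R).
    by move=> x /=; rewrite !in_itv /= => /andP[-> /ltW].
  have itv_int :
      lebesgue_measure.-integrable `[u, v] (EFin \o (fun x : R => x ^+ n)).
    apply: continuous_compact_integrable; first exact: segment_compact.
    by apply: continuous_in_subspaceT => x _; exact: exprn_continuous.
  exact: (@integrableS _ (measurableTypeR R) _ _ _ _ _ _ _ itv_sub itv_int).
have := @Rintegral_setX_mul _ _ (measurableTypeR R) (measurableTypeR R) R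
  lebesgue_measure lebesgue_measure `[a, b[%classic `[c, d[%classic
  (fun x => x ^+ p) (fun y => y ^+ q).
have intE (u v : R) n : u < v ->
    \int[lebesgue_measure]_(x in `[u, v[) (x ^+ n) =
    (v ^+ n.+1 - u ^+ n.+1) / n.+1%:R.
  by move=> uv; rewrite /Rintegral integral_power.
move=> H; rewrite -!intE //; apply: H => //.
exact: integrable_monomial.
Qed.

End Rectangle.

Lemma integrable_EFin_sum d (T : measurableType d) (R : realType)
    (mu : {measure set T -> \bar R}) (D : set T) (I : Type) (s : seq I)
    (P : pred I) (f : I -> T -> R) : measurable D ->
  (forall i, mu.-integrable D (EFin \o f i)) ->
  mu.-integrable D (EFin \o (fun x => \sum_(i <- s | P i) f i x)).
Proof.
move=> mD intf.
rewrite (_ : EFin \o _ = fun x => (\sum_(i <- s | P i) (EFin \o f i) x)%E).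
  by apply: integrable_sum.
by apply/funext => x /=; rewrite sumEFin.
Qed.

Lemma Rintegral_sum d (T : measurableType d) (R : realType)
    (mu : {measure set T -> \bar R}) (D : set T) (I : Type) (s : seq I)
    (P : pred I) (f : I -> T -> R) : measurable D ->
  (forall i, mu.-integrable D (EFin \o f i)) ->
  \int[mu]_(x in D) (\sum_(i <- s | P i) f i x) =
  \sum_(i <- s | P i) \int[mu]_(x in D) f i x.
Proof.
move=> mD intf; elim: s => [|i s ih].
  under eq_Rintegral do rewrite big_nil.
  by rewrite Rintegral_cst // big_nil mul0r.
rewrite big_cons -ih; case: ifPn => Pi.
  rewrite -RintegralD //; last exact: integrable_EFin_sum.
  by apply: eq_Rintegral => x _; rewrite big_cons Pi.
by apply: eq_Rintegral => x _; rewrite big_cons (negbTE Pi).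
Qed.

Lemma cell_side_lt (R : realType) (dx : R) (i : int) : 0 < dx ->
  (i%:~R - one_half) * dx < (i%:~R + one_half) * dx.
Proof. by move=> dx0; rewrite ltr_pM2r // /one_half; lra. Qed.

Section CellMeasure.
Context {R : realType} (dx1 dx2 : R).

Lemma measurable_cell i j :
  measurable (cell dx1 dx2 i j : set (measurableTypeR R * measurableTypeR R)).
Proof. exact: measurable_rectangle. Qed.

Lemma lebesgue2_cell i j : 0 < dx1 -> 0 < dx2 ->
  lebesgue2 (cell dx1 dx2 i j) = (dx1 * dx2)%:E.
Proof.
move=> dx1_gt0 dx2_gt0; rewrite /cell lebesgue2_rectangle ?cell_side_lt //.
by rewrite /one_half; congr EFin; field.
Qed.

End CellMeasure.

(** * Product quadrature rules exact for quadratic polynomials *)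

Section Quadrature.
Context {R : realType}.
Implicit Types (h c : R) (s : seq (R * R)).

(** A rule is a list of pairs (weight, node); its weights are meant to sum to 1,
    so that it approximates averages rather than integrals. *)
Definition quadrature s (g : R -> R) : R := \sum_(a <- s) a.1 * g a.2.

(** The right-hand side is the average of the [n]-th power over the interval of
    length [h] centred at [c * h]. *)
Definition exact_on_quadratics h c s := forall n, (n <= 2)%N ->
  quadrature s (fun x => x ^+ n) =
  h^-1 * ((((c + one_half) * h) ^+ n.+1 -
           ((c - one_half) * h) ^+ n.+1) / n.+1%:R).

Definition simpson h c : seq (R * R) :=
  [:: (6^-1, (c - one_half) * h); (4 / 6, c * h); (6^-1, (c + one_half) * h)].

Definition gauss h c : seq (R * R) :=
  [seq (2^-1, (c + xi * gauss_node) * h) | xi <- pm1].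

Lemma simpson_exact h c : 0 < h -> exact_on_quadratics h c (simpson h c).
Proof.
move=> h0; have hn : h != 0 by rewrite gt_eqF.
by case=> [|[|[|//]]] _;
  rewrite /quadrature !big_cons big_nil /= /one_half; field.
Qed.

Lemma gauss_node_sqr : gauss_node ^+ 2 = 12^-1 :> R.
Proof. by rewrite /gauss_node exprVn exprMn sqr_sqrtr //; field. Qed.

Lemma gauss_exact h c : 0 < h -> exact_on_quadratics h c (gauss h c).
Proof.
move=> h0; have hn : h != 0 by rewrite gt_eqF.
have g2 := gauss_node_sqr.
case=> [|[|[|//]]] _; rewrite /quadrature !big_cons big_nil /= /one_half.
- by field.
- by field.
- rewrite addr0.
  transitivity ((c ^+ 2 + gauss_node ^+ 2) * h ^+ 2); first by field.
  by rewrite g2; field.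
Qed.

Lemma quadrature_sum s (I : Type) (r : seq I) (Q : pred I) (g : I -> R -> R) :
  quadrature s (fun x => \sum_(i <- r | Q i) g i x) =
  \sum_(i <- r | Q i) quadrature s (g i).
Proof.
by rewrite /quadrature exchange_big /=; apply: eq_bigr => a _; rewrite mulr_sumr.
Qed.

Lemma quadratureZ s k (g : R -> R) :
  quadrature s (fun x => k * g x) = k * quadrature s g.
Proof.
by rewrite /quadrature mulr_sumr; apply: eq_bigr => a _; rewrite mulrCA.
Qed.

Lemma eq_quadrature s (g g' : R -> R) :
  g =1 g' -> quadrature s g = quadrature s g'.
Proof. by move=> gg'; apply: eq_bigr => a _; rewrite gg'. Qed.

Lemma quadratureD s (g g' : R -> R) :
  quadrature s (fun x => g x + g' x) = quadrature s g + quadrature s g'.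
Proof.
by rewrite /quadrature -big_split; apply: eq_bigr => a _; rewrite mulrDr.
Qed.

Lemma quadrature_cst h c s k : h != 0 -> exact_on_quadratics h c s ->
  quadrature s (fun=> k) = k.
Proof.
move=> h0 /(_ 0%N isT); under eq_quadrature do rewrite expr0.
move=> one; have -> : quadrature s (fun=> k) = k * quadrature s (fun=> 1).
  by rewrite -quadratureZ mulr1.
by rewrite one /one_half; field.
Qed.

(** Both sides are linear in [P], so it suffices to compare them on the
    monomials [x ^ p * y ^ q]; there both factorize, and each exponent is at
    most 2. *)
Lemma cell_average_quadrature (dx1 dx2 : R) (s1 s2 : seq (R * R)) (i j : int)
    (P : R * R -> R) : 0 < dx1 -> 0 < dx2 ->
  exact_on_quadratics dx1 i%:~R s1 -> exact_on_quadratics dx2 j%:~R s2 ->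
  polynomial_of_degree_le 2 P ->
  cell_average dx1 dx2 P i j =
  quadrature s1 (fun x => quadrature s2 (fun y => P (x, y))).
Proof.
move=> dx1_gt0 dx2_gt0 ex1 ex2 [c Pc].
have lt1 := cell_side_lt i dx1_gt0; have lt2 := cell_side_lt j dx2_gt0.
have im p q := integrable_monomial lt1 lt2 p q.
have mC := measurable_cell dx1 dx2 i j.
pose m p q (x : R * R) := x.1 ^+ p * x.2 ^+ q.
have {}Pc x :
    P x = \sum_(p < 3) \sum_(q < 3 | (p + q <= 2)%N) c p q * m p q x.
  by rewrite Pc; apply: eq_bigr => p _; apply: eq_bigr => q _; rewrite mulrA.
have icm p q : lebesgue2.-integrable (cell dx1 dx2 i j)
    (EFin \o (fun x => c p q * m p q x)).
  have := integrableZl mC (c p q) (im p q).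
  by congr (_.-integrable _ _); apply/funext => x /=; rewrite EFinM.
rewrite /cell_average; under eq_Rintegral do rewrite Pc.
rewrite Rintegral_sum //; last by move=> p; exact: integrable_EFin_sum.
rewrite mulr_sumr; transitivity (\sum_(p < 3) \sum_(q < 3 | (p + q <= 2)%N)
    c p q * (quadrature s1 (fun x => x ^+ p) *
             quadrature s2 (fun x => x ^+ q))).
  apply: eq_bigr => p _; rewrite Rintegral_sum // mulr_sumr.
  apply: eq_bigr => q _; rewrite RintegralZl //; last exact: im.
  have -> := Rintegral_monomial lt1 lt2 p q.
  rewrite (ex1 _ (ltn_ord p)) (ex2 _ (ltn_ord q)) invfM.
  by set A := _ / p.+1%:R; set B := _ / q.+1%:R; ring.
rewrite [RHS](eq_quadrature _ (g' := fun x => \sum_(p < 3)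
  \sum_(q < 3 | (p + q <= 2)%N)
    (c p q * quadrature s2 (fun y => y ^+ q)) * x ^+ p)).
  rewrite quadrature_sum; apply: eq_bigr => p _; rewrite quadrature_sum.
  by apply: eq_bigr => q _; rewrite quadratureZ; ring.
move=> x; under eq_quadrature do rewrite Pc.
rewrite quadrature_sum; apply: eq_bigr => p _; rewrite quadrature_sum.
apply: eq_bigr => q _; under eq_quadrature do rewrite /m /= mulrA.
by rewrite quadratureZ mulrAC.
Qed.

End Quadrature.

(** * Polynomials on the closure of a cell *)

Section RectangleClosure.
Context {R : realType}.
Variables (a b c d : R).
Hypotheses (ab : a < b) (cd : c < d).

(** Fluxes are evaluated on the sides of half-open cells, which the limiter
    reaches only through the closure. *)
Lemma closure_itv_co (u v x : R) : u < v -> u <= x <= v -> closure `[u, v[ x.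
Proof.
move=> uv /andP[ux xv]; have [->{xv}|xv'] := eqVneq x v; last first.
  by apply: subset_closure; rewrite /= in_itv /= ux lt_neqAle xv' xv.
have supE : sup `[u, v[%classic = v by rewrite real_interval.sup_itv ?bnd_simp.
rewrite -[X in closure _ X]supE; apply: closure_sup.
  by exists u; rewrite /= in_itv /= lexx.
by exists v => y /=; rewrite in_itv /= => /andP[_ /ltW].
Qed.

Lemma closure_rectangle :
  `[a, b] `*` `[c, d] `<=` closure (`[a, b[ `*` `[c, d[).
Proof.
move=> [x y] [/= xab ycd] U [[U1 U2] /= [xU1 yU2] U12].
rewrite in_itv /= in xab; rewrite in_itv /= in ycd.
have [x' [x'ab U1x']] := closure_itv_co ab xab xU1.
have [y' [y'cd U2y']] := closure_itv_co cd ycd yU2.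
by exists (x', y'); split => //; apply: U12.
Qed.

Lemma closure_rectangle_le p : closure (`[a, b[ `*` `[c, d[) p ->
  a <= p.1 <= b /\ c <= p.2 <= d.
Proof.
have sub (u v : R) : `[u, v[%classic `<=` ([set` `[u, v]] : set R).
  by move=> x /=; rewrite !in_itv /= => /andP[-> /ltW].
move=> pC; split.
- suff : closure `[a, b] p.1.
    rewrite -(closure_id _).1 //=; last exact: itv_closed.
  move=> U pU; have [|q [[/sub ? _] Uq]] := pC (fst @^-1` U).
    exact: cvg_fst.
  by exists q.1.
- suff : closure `[c, d] p.2.
    rewrite -(closure_id _).1 //=; last exact: itv_closed.
  move=> U pU; have [|q [[_ /sub ?] Uq]] := pC (snd @^-1` U).
    exact: cvg_snd.
  by exists q.2.
Qed.

Lemma polynomial_bounded n P : polynomial_of_degree_le n P ->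
  exists M, forall x, a <= x.1 <= b -> c <= x.2 <= d -> `|P x| <= M.
Proof.
move=> [co Pco]; pose A := `|a| + `|b|; pose C := `|c| + `|d|.
exists (\sum_(p < n.+1) \sum_(q < n.+1 | (p + q <= n)%N)
  `|co p q| * A ^+ p * C ^+ q).
move=> x xab xcd; rewrite Pco; apply: (le_trans (ler_norm_sum _ _ _)).
apply: ler_sum => p _; apply: (le_trans (ler_norm_sum _ _ _)).
apply: ler_sum => q _; rewrite !normrM !normrX.
apply: ler_pM => //; rewrite ?mulr_ge0 ?exprn_ge0 //.
  apply: ler_wpM2l => //.
  by apply: lerXn2r; rewrite ?nnegrE ?ler_norm_endpoints ?addr_ge0.
by apply: lerXn2r; rewrite ?nnegrE ?ler_norm_endpoints ?addr_ge0.
Qed.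

End RectangleClosure.

(** * The linear scaling limiter *)

Section Limiter.
Context {R : realType}.
Variables (I : set R) (C : set (R * R)) (a : R) (P : R * R -> R).

Let th := limiter_theta I C a P.
Let Pmax := sup [set P x | x in closure C].
Let Pmin := inf [set P x | x in closure C].
Let q1 := limiter_quotient (ereal_sup (EFin @` I)) a Pmax.
Let q2 := limiter_quotient (ereal_inf (EFin @` I)) a Pmin.

Lemma limiter_quotient_ge0 s (u v : R) : (0 <= limiter_quotient s u v)%E.
Proof. by rewrite /limiter_quotient; case: ifP => _ //; rewrite lee_fin. Qed.

Lemma limiter_thetaE : (th%:E = Order.min (Order.min q1 q2) 1)%E.
Proof.
rewrite /th /limiter_theta -/Pmax -/Pmin fineK //.
rewrite ge0_fin_numE; first by rewrite gt_min ltry orbT.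
by rewrite !le_min !limiter_quotient_ge0 lee_fin ler01.
Qed.

Lemma limiter_theta_ge0 : 0 <= th.
Proof.
by rewrite -lee_fin limiter_thetaE !le_min !limiter_quotient_ge0 lee_fin ler01.
Qed.

(** Where [P] exceeds [a], its excess is at most [Pmax - a], which the factor
    shrinks to at most [s - a]; where it does not, [a <= s] suffices. *)
Lemma limiter_le_sup s x : ereal_sup (EFin @` I) = s%:E -> a <= s ->
  has_ubound [set P x | x in closure C] -> closure C x ->
  a + th * (P x - a) <= s.
Proof.
move=> sE as_ ub Cx; have th0 := limiter_theta_ge0.
have xmax : P x <= Pmax by apply: ub_le_sup => //; exists x.
have [Pa|aP] := leP Pmax a.
  have : th * (P x - a) <= 0 by rewrite mulr_ge0_le0 // subr_le0 (le_trans xmax).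
  lra.
have : th <= (s - a) / (Pmax - a).
  rewrite -lee_fin limiter_thetaE !ge_min /q1 /limiter_quotient sE /=.
  rewrite subr_eq0 gt_eqF //= ger0_norm ?lexx //.
  by rewrite divr_ge0 ?subr_ge0 // ltW.
rewrite ler_pdivlMr ?subr_gt0 // => thle.
have : th * (P x - a) <= th * (Pmax - a) by rewrite ler_wpM2l // lerD2r.
lra.
Qed.

Lemma limiter_ge_inf s x : ereal_inf (EFin @` I) = s%:E -> s <= a ->
  has_lbound [set P x | x in closure C] -> closure C x ->
  s <= a + th * (P x - a).
Proof.
move=> sE as_ lb Cx; have th0 := limiter_theta_ge0.
have xmin : Pmin <= P x by apply: ge_inf => //; exists x.
have [Pa|aP] := leP a Pmin.
  have : 0 <= th * (P x - a) by rewrite mulr_ge0 // subr_ge0 (le_trans _ xmin).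
  lra.
have : th <= (a - s) / (a - Pmin).
  rewrite -lee_fin limiter_thetaE !ge_min /q2 /limiter_quotient sE /=.
  have -> : (s - a) / (Pmin - a) = (a - s) / (a - Pmin).
    by rewrite -mulrNN -invrN !opprB.
  rewrite subr_eq0 lt_eqF //=.
  rewrite ger0_norm ?lexx ?orbT //.
  by rewrite divr_ge0 ?subr_ge0 // ltW.
rewrite ler_pdivlMr ?subr_gt0 // => thle.
have : th * (a - P x) <= th * (a - Pmin) by rewrite ler_wpM2l // lerD2l lerN2.
lra.
Qed.

End Limiter.

(** * The forward Euler step *)

(** With [s = 1] the point [b] is the least element of [I], with [s = -1] the
    greatest one.  The sign allows one argument to serve for the lower and the
    upper bound; [s * (z - b)] is then the distance from [z] to [b]. *)
Definition one_sided_bound {R : realType} (I : set R) (s b : R) : Prop :=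
  [/\ s = 1 \/ s = -1, I b & forall z, I z -> 0 <= s * (z - b)].

(** The two fluxes are taken at different positions and nonlocal states, so they
    can only be compared through the value [F b b = 0], which they share.  For
    [s = 1] this is the chain
    [F u v <= F u b <= F b b + L1 * (u - b)] on one side and
    [F u' v' >= F b v' >= F b b - L2 * (v' - b)] on the other. *)
Lemma flux_difference_le (R : realType) (M : nat) (I : set R)
    (fl : R -> R * R -> R -> 'rV[R]_M -> R) F (L1 L2 s b t : R) x r x' r'
    (u v u' v' : R) :
  monotone_based_flux I fl F L1 L2 -> one_sided_bound I s b -> 0 <= t ->
  (forall x r, fl t x b r = 0) -> I u -> I v -> I u' -> I v' ->
  s * (F u v t x r - F u' v' t x' r') <=
    L1 * (s * (u - b)) + L2 * (s * (v' - b)).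
Proof.
move=> hF [s1 Ib Is] t0 fb0 Iu Iv Iu' Iv'.
have F0 y q : F b b t y q = 0 by rewrite (flux_consistent hF) // fb0.
have sN (z : R) : I z -> `|z - b| = s * (z - b).
  move=> /Is; case: s1 => -> ; first by rewrite mul1r => /ger0_norm.
  by rewrite mulN1r oppr_ge0 => /ler0_norm.
have := flux_lipschitz1 hF x r t0 Iu Ib Ib.
have := flux_lipschitz2 hF x' r' t0 Ib Iv' Ib.
rewrite !F0 !subr0 !sN //.
move: (Is _ Iu) (Is _ Iv) (Is _ Iu') (Is _ Iv').
case: s1 => ->; rewrite ?mul1r ?mulN1r ?oppr_ge0 ?subr_ge0 ?subr_le0.
- move=> bu bv bu' bv' h2 h1.
  have := flux_nonincreasing hF x r t0 Iu Ib Iv bv.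
  have := flux_nondecreasing hF x' r' t0 Ib Iu' Iv' bu'.
  move: h1 h2; rewrite !ler_norml => /andP[_ h1] /andP[h2 _]; lra.
- move=> bu bv bu' bv' h2 h1.
  have := flux_nonincreasing hF x r t0 Iu Iv Ib bv.
  have := flux_nondecreasing hF x' r' t0 Iu' Ib Iv' bu'.
  move: h1 h2; rewrite !ler_norml => /andP[h1 _] /andP[_ h2]; lra.
Qed.

Section Cells.
Context {R : realType} (dx1 dx2 : R).
Hypotheses (dx1_gt0 : 0 < dx1) (dx2_gt0 : 0 < dx2).

Lemma gauss_node_bounds : 0 <= (gauss_node : R) <= 2^-1.
Proof.
have g0 : 0 <= (gauss_node : R) by rewrite /gauss_node invr_ge0 mulr_ge0 ?sqrtr_ge0.
rewrite g0 -(@ler_pXn2r _ 2) ?nnegrE ?invr_ge0 ?ler0n //.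
by rewrite gauss_node_sqr exprVn lef_pV2 ?posrE ?exprn_gt0 //; lra.
Qed.

Lemma closure_cell (i j : int) (a b : R) :
  i%:~R - 2^-1 <= a <= i%:~R + 2^-1 -> j%:~R - 2^-1 <= b <= j%:~R + 2^-1 ->
  closure (cell dx1 dx2 i j) (a * dx1, b * dx2).
Proof.
move=> ia jb; apply: closure_rectangle; rewrite ?cell_side_lt //.
by split; rewrite /= in_itv /= !ler_pM2r.
Qed.

Lemma polynomial_bounded_cell n P (i j : int) : polynomial_of_degree_le n P ->
  has_ubound [set P x | x in closure (cell dx1 dx2 i j)] /\
  has_lbound [set P x | x in closure (cell dx1 dx2 i j)].
Proof.
move=> Pn.
have [B PB] := polynomial_bounded ((i%:~R - one_half) * dx1)
  ((i%:~R + one_half) * dx1) ((j%:~R - one_half) * dx2)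
  ((j%:~R + one_half) * dx2) Pn.
split; [exists B | exists (- B)] => _ [x Cx <-].
  have [h1 h2] := closure_rectangle_le Cx.
  by have := PB x h1 h2; rewrite ler_norml => /andP[].
have [h1 h2] := closure_rectangle_le Cx.
by have := PB x h1 h2; rewrite ler_norml => /andP[].
Qed.

(** [v] is given by both product rules: Simpson's rule in the first direction
    controls the fluxes through the left and right sides, Simpson's rule in the
    second direction those through the lower and upper sides. *)
Lemma euler_step {K M : nat} (I : set R) (eta : 'I_M -> 'I_K -> R * R -> R)
   (f1 f2 : R -> R * R -> R -> 'rV[R]_M -> R)
   (F1 F2 : 'I_K -> R -> R -> R -> R * R -> 'rV[R]_M -> R) (L11 L12 L21 L22 : R)
   (P : reconstruction R K) (k : 'I_K) (i j : int) (v s b t h : R) :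
  monotone_based_flux I f1 (F1 k) L11 L12 ->
  monotone_based_flux I f2 (F2 k) L21 L22 ->
  one_sided_bound I s b -> 0 <= t -> 0 <= h ->
  (forall x r, f1 t x b r = 0) -> (forall x r, f2 t x b r = 0) ->
  (forall i j x, closure (cell dx1 dx2 i j) x -> I (P k i j x)) ->
  v = quadrature (simpson dx1 i%:~R) (fun x =>
        quadrature (gauss dx2 j%:~R) (fun y => P k i j (x, y))) ->
  v = quadrature (gauss dx1 i%:~R) (fun x =>
        quadrature (simpson dx2 j%:~R) (fun y => P k i j (x, y))) ->
  h / dx1 * (L11 + L12) + h / dx2 * (L21 + L22) <= 6^-1 ->
  0 <= s * (v + h * semidiscrete_operator dx1 dx2 eta F1 F2 P t k i j - b).
Proof.
move=> hF1 hF2 bar t0 h0 f10 f20 IP v1 v2 cfl.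
have [g0 g1] := andP gauss_node_bounds.
have [_ _ Ib] := bar.
have IP' (i' j' : int) (a c : R) :
    i'%:~R - 2^-1 <= a <= i'%:~R + 2^-1 -> j'%:~R - 2^-1 <= c <= j'%:~R + 2^-1 ->
    I (P k i' j' (a * dx1, c * dx2)).
  by move=> ha hc; apply/IP/closure_cell.
(* [d1 xi] and [d2 xi] are the flux differences on the Gauss line [xi]. *)
pose x := grid_point dx1 dx2.
pose G F (a c u w : R) : R :=
  F k u w t (x a c) (nonlocal dx1 dx2 eta P a c) : R.
pose ir : R := i%:~R; pose jr : R := j%:~R.
pose d1 xi := G F1 (ir + one_half) (jr + xi * gauss_node)
             (P k i j (x (ir + one_half) (jr + xi * gauss_node)))
             (P k (i + 1) j (x (ir + one_half) (jr + xi * gauss_node)))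
           - G F1 (ir - one_half) (jr + xi * gauss_node)
             (P k (i - 1) j (x (ir - one_half) (jr + xi * gauss_node)))
             (P k i j (x (ir - one_half) (jr + xi * gauss_node))).
pose d2 xi := G F2 (ir + xi * gauss_node) (jr + one_half)
             (P k i j (x (ir + xi * gauss_node) (jr + one_half)))
             (P k i (j + 1) (x (ir + xi * gauss_node) (jr + one_half)))
           - G F2 (ir + xi * gauss_node) (jr - one_half)
             (P k i (j - 1) (x (ir + xi * gauss_node) (jr - one_half)))
             (P k i j (x (ir + xi * gauss_node) (jr - one_half))).
have -> : semidiscrete_operator dx1 dx2 eta F1 F2 P t k i j =
  - \sum_(xi <- pm1) ((2 * dx1)^-1 * d1 xi + (2 * dx2)^-1 * d2 xi) by [].
(* The distances from [b] of the value of [P] at a point and of the average. *)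
pose e a c := s * (P k i j (x a c) - b).
have e0 a c : `|a - ir| <= 2^-1 -> `|c - jr| <= 2^-1 -> 0 <= e a c.
  by rewrite !ler_distl => ha hc; apply/Ib/IP'.
have xi_le (xi : R) : `|xi| = 1 -> `|xi * gauss_node| <= 2^-1.
  by move=> xi1; rewrite normrM xi1 mul1r ger0_norm.
have d1_le xi : `|xi| = 1 -> s * d1 xi <=
    L11 * e (ir + one_half) (jr + xi * gauss_node) +
    L12 * e (ir - one_half) (jr + xi * gauss_node).
  move=> /xi_le; rewrite ler_norml => /andP[h1 h2].
  rewrite /d1 /e /G; apply: (flux_difference_le _ _ _ _ hF1 bar) => //;
    apply: IP';
    rewrite ?intrD ?rmorphN /one_half /ir /jr; lra.
have d2_le xi : `|xi| = 1 -> s * d2 xi <=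
    L21 * e (ir + xi * gauss_node) (jr + one_half) +
    L22 * e (ir + xi * gauss_node) (jr - one_half).
  move=> /xi_le; rewrite ler_norml => /andP[h1 h2].
  rewrite /d2 /e /G; apply: (flux_difference_le _ _ _ _ hF2 bar) => //;
    apply: IP';
    rewrite ?intrD ?rmorphN /one_half /ir /jr; lra.
have [[L11_ge0 L12_ge0] [L21_ge0 L22_ge0]] :=
  (flux_lipschitz_ge0 hF1, flux_lipschitz_ge0 hF2).
have node1 : `|-1 : R| = 1 by rewrite normrN normr1.
have node2 : `|1 : R| = 1 by rewrite normr1.
have half_le (a : R) :
    `|a + one_half - a| <= 2^-1 /\ `|a - one_half - a| <= 2^-1.
  by rewrite !(addrC a) !addrK normrN ger0_norm /one_half ?invr_ge0 // lexx.
have self_le (a : R) : `|a - a| <= 2^-1 by rewrite subrr normr0 invr_ge0.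
have gauss_le (a xi : R) : `|xi| = 1 -> `|a + xi * gauss_node - a| <= 2^-1.
  by rewrite addrC addrA addNr add0r => /xi_le.
pose w := s * (v - b).
(* The rules for [v] hold for [w] as well, since their weights sum to 1. *)
have w1E : w = 6^-1 * \sum_(xi <- pm1) (2^-1 *
  (e (ir - one_half) (jr + xi * gauss_node) + 4 * e ir (jr + xi * gauss_node) +
   e (ir + one_half) (jr + xi * gauss_node))).
  rewrite /w v1 /quadrature /simpson /gauss /pm1 !big_cons !big_nil /=.
  by rewrite /e /x /grid_point -/ir -/jr; field.
have w2E : w = 6^-1 * \sum_(xi <- pm1) (2^-1 *
  (e (ir + xi * gauss_node) (jr - one_half) + 4 * e (ir + xi * gauss_node) jr +
   e (ir + xi * gauss_node) (jr + one_half))).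
  rewrite /w v2 /quadrature /simpson /gauss /pm1 !big_cons !big_nil /=.
  by rewrite /e /x /grid_point -/ir -/jr; field.
have A1_ge0 : 0 <= h / dx1 by rewrite divr_ge0 // ltW.
have A2_ge0 : 0 <= h / dx2 by rewrite divr_ge0 // ltW.
have mix (L L' p q : R) : 0 <= L -> 0 <= L' -> 0 <= p -> 0 <= q ->
    L * p + L' * q <= (L + L') * (p + q) by nra.
(* Each interface value has weight 1/12 in the rule; the midpoint terms of
   Simpson's rule are nonnegative and are dropped. *)
have D1 : \sum_(xi <- pm1) s * d1 xi <= 12 * ((L11 + L12) * w).
  apply: (@le_trans _ _ ((L11 + L12) * \sum_(xi <- pm1)
    (e (ir + one_half) (jr + xi * gauss_node) +
     e (ir - one_half) (jr + xi * gauss_node)))).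
    have le_xi xi : `|xi| = 1 -> s * d1 xi <= (L11 + L12) *
        (e (ir + one_half) (jr + xi * gauss_node) +
         e (ir - one_half) (jr + xi * gauss_node)).
      move=> xi1; apply: (le_trans (d1_le _ xi1)); apply: mix => //;
        by apply: e0; rewrite ?(half_le _).1 ?(half_le _).2 ?gauss_le.
    by rewrite mulr_sumr !big_cons !big_nil !addr0 lerD ?le_xi.
  rewrite mulrCA ler_wpM2l ?addr_ge0 // w1E !big_cons !big_nil.
  have := e0 _ _ (self_le ir) (gauss_le jr _ node1).
  have := e0 _ _ (self_le ir) (gauss_le jr _ node2).
  lra.
have D2 : \sum_(xi <- pm1) s * d2 xi <= 12 * ((L21 + L22) * w).
  apply: (@le_trans _ _ ((L21 + L22) * \sum_(xi <- pm1)
    (e (ir + xi * gauss_node) (jr + one_half) +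
     e (ir + xi * gauss_node) (jr - one_half)))).
    have le_xi xi : `|xi| = 1 -> s * d2 xi <= (L21 + L22) *
        (e (ir + xi * gauss_node) (jr + one_half) +
         e (ir + xi * gauss_node) (jr - one_half)).
      move=> xi1; apply: (le_trans (d2_le _ xi1)); apply: mix => //;
        by apply: e0; rewrite ?(half_le _).1 ?(half_le _).2 ?gauss_le.
    by rewrite mulr_sumr !big_cons !big_nil !addr0 lerD ?le_xi.
  rewrite mulrCA ler_wpM2l ?addr_ge0 // w2E !big_cons !big_nil.
  have := e0 _ _ (gauss_le ir _ node1) (self_le jr).
  have := e0 _ _ (gauss_le ir _ node2) (self_le jr).
  lra.
have w_ge0 : 0 <= w.
  rewrite w1E mulr_ge0 ?invr_ge0 // big_seq sumr_ge0 // => xi.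
  rewrite !inE => xi1; have {}xi1 : `|xi| = 1 by case/orP: xi1 => /eqP ->.
  apply: mulr_ge0; first by rewrite invr_ge0.
  apply: addr_ge0; first apply: addr_ge0; last 2 first.
  - by apply: mulr_ge0 => //; apply: e0; rewrite ?self_le ?gauss_le.
  - by apply: e0; rewrite ?(half_le _).1 ?gauss_le.
  - by apply: e0; rewrite ?(half_le _).2 ?gauss_le.
have -> : s * (v + h * - \sum_(xi <- pm1)
    ((2 * dx1)^-1 * d1 xi + (2 * dx2)^-1 * d2 xi) - b) =
    w - h / dx1 * (2^-1 * \sum_(xi <- pm1) s * d1 xi)
      - h / dx2 * (2^-1 * \sum_(xi <- pm1) s * d2 xi).
  by rewrite !big_cons !big_nil /w; field; rewrite !gt_eqF.
have := ler_wpM2l A1_ge0 D1; have := ler_wpM2l A2_ge0 D2.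
have := ler_wpM2r w_ge0 cfl.
lra.
Qed.

End Cells.

(** * Intervals whose endpoints are zeros of the flux *)

(** [Z] is the property of the endpoints; an interval unbounded above has only
    one. *)
Definition interval_with_endpoints {R : realType} (Z : R -> Prop)
    (I : set R) : Prop :=
  exists m, Z m /\ (I = [set z | m <= z] \/
                    exists M, Z M /\ I = [set z | m <= z <= M]).

(** Membership is tested one endpoint at a time.  The element [v] makes [I]
    nonempty, so that its endpoints belong to it. *)
Lemma mem_interval (R : realType) (Z : R -> Prop) (I : set R) (v z : R) :
  interval_with_endpoints Z I -> I v ->
  (forall s b, Z b -> one_sided_bound I s b -> 0 <= s * (z - b)) -> I z.
Proof.
move=> [m [Zm [->|[M [ZM ->]]]]] /= Iv zP.
  rewrite -subr_ge0 -[_ - _]mul1r; apply: zP => //.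
  by split => //=; [left | move=> y /=; rewrite mul1r subr_ge0].
have /andP[mv vM] := Iv; have mM := le_trans mv vM.
apply/andP; split.
  rewrite -subr_ge0 -[_ - _]mul1r; apply: zP => //.
  split => /=; [by left | by rewrite lexx |].
  by move=> y /andP[? _]; rewrite mul1r subr_ge0.
rewrite -subr_ge0 -opprB -mulN1r; apply: zP => //.
split => /=; [by right | by rewrite lexx andbT |].
by move=> y /andP[_ ?]; rewrite mulN1r opprB subr_ge0.
Qed.

Lemma limiter_mem (R : realType) (Z : R -> Prop) (I : set R) C (a : R) P x :
  interval_with_endpoints Z I -> I a ->
  has_ubound [set P x | x in closure C] ->
  has_lbound [set P x | x in closure C] ->
  closure C x -> I (a + limiter_theta I C a P * (P x - a)).
Proof.
move=> FI Ia Pub Plb Cx.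
apply: (mem_interval FI Ia) => s b _ [s1 Ib Is].
case: s1 Is => -> Is.
  rewrite mul1r subr_ge0; apply: limiter_ge_inf => //.
    apply/eqP; rewrite eq_le; apply/andP; split.
      by apply: ereal_inf_lbound; exists b.
    apply: le_ereal_inf_tmp => _ [y Iy <-].
    by rewrite lee_fin -subr_ge0 -[_ - _]mul1r Is.
  by rewrite -subr_ge0 -[_ - _]mul1r Is.
rewrite mulN1r opprB subr_ge0; apply: limiter_le_sup => //.
  apply/eqP; rewrite eq_le; apply/andP; split.
    apply: ge_ereal_sup => _ [y Iy <-].
    by rewrite lee_fin -subr_ge0 -opprB -mulN1r Is.
  by apply: ereal_sup_ubound; exists b.
by rewrite -subr_ge0 -opprB -mulN1r Is.
Qed.

(** * Strong stability preserving methods *)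

Lemma sumr_ge0_all (R : realType) (T : Type) (p : pred T) (r : seq T)
    (F : T -> R) :
  all p r -> (forall x, p x -> 0 <= F x) -> 0 <= \sum_(x <- r) F x.
Proof.
move=> + F0; elim: r => [|x r ih] /=; first by rewrite big_nil.
by move=> /andP[/F0 ? /ih ?]; rewrite big_cons addr_ge0.
Qed.

Lemma interval_convex_sum (R : realType) (Z : R -> Prop) (I : set R) (T : Type)
    (p : pred T) (r : seq T) (al z : T -> R) :
  interval_with_endpoints Z I -> all p r -> \sum_(x <- r) al x = 1 ->
  (forall x, p x -> 0 <= al x /\ I (z x)) -> I (\sum_(x <- r) al x * z x).
Proof.
move=> FI pr al1 alz.
have [v Iv] : exists v, I v.
  case: r pr al1 => [_|x r /= /andP[/alz[_ ?] _] _]; last by exists (z x).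
  by rewrite big_nil => /eqP; rewrite eq_sym oner_eq0.
apply: (mem_interval FI Iv) => s b _ [_ _ Is].
rewrite -[b in _ - b]mul1r -al1 mulr_suml -sumrB mulr_sumr.
apply: (sumr_ge0_all pr) => x /alz[al0 /Is h].
by rewrite -mulrBr mulrCA mulr_ge0.
Qed.

Section SSP.
Context {R : realType} {K : nat} (m : ssp_scheme R).

(** The minimum defining [C_SSP] is over a list of terms, a type without
    decidable equality; hence the formulation with [all] instead of list membership. *)
Lemma C_SSP_le i : (i < nstages m)%N ->
  all (fun r => (0 < term_beta r) ==>
         (C_SSP m <= (term_alpha r / term_beta r)%:E)%E) (stage_terms m i).
Proof.
have bigmin_all (s : seq (ssp_term R)) :
    all (fun r => (0 < term_beta r) ==>
         (\big[Order.min/+oo%E]_(r <- s | (0 < term_beta r)%R)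
           (term_alpha r / term_beta r)%:E <= (term_alpha r / term_beta r)%:E)%E) s.
  elim: s => [//|r s ih]; rewrite /= big_cons; case: ifP => br /=.
    rewrite ge_min lexx /=; apply: sub_all ih => r' /implyP h; apply/implyP => /h.
    by rewrite ge_min => ->; rewrite orbT.
  exact: ih.
rewrite /C_SSP /stage_terms /nstages; move: (bigmin_all (flatten (ssp_stages m))).
set B := \big[_/_]_(r <- _ | _) _; move: B => B.
elim: (ssp_stages m) i => [//|s ss ih] [|i] /=; rewrite all_cat => /andP[// + hss].
by move=> _; exact: ih.
Qed.

(** A term of a stage is a forward Euler step of length
    [h = term_beta r / term_alpha r * dt], and [h * c <= kappa] because
    [C_SSP m <= term_alpha r / term_beta r].  If [term_beta r = 0] then [h = 0],
    which is how a method with infinite [C_SSP] is covered. *)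
Lemma ssp_invariant (Z : 'I_K -> R -> Prop) (I : 'I_K -> set R) (dt c kappa : R)
    (L : R -> state R K -> state R K) u w tau :
  (forall k, interval_with_endpoints (Z k) (I k)) -> ssp_valid m -> 0 < dt ->
  (forall t h v, 0 <= t -> 0 <= h -> h * c <= kappa ->
    (forall k i j, I k (v k i j)) ->
    forall k i j, I k (v k i j + h * L t v k i j)) ->
  0 <= kappa -> ((dt * c)%:E <= C_SSP m * kappa%:E)%E ->
  (forall n, (n <= ssp_depth m)%N -> forall k i j, I k (u n k i j)) ->
  ssp_solution m dt L u w tau ->
  forall n k i j, I k (u n k i j).
Proof.
move=> FI [st0 val] dt0 euler kappa0 cfl start sol n.
elim/ltn_ind: n => n IH; have [|dn] := leqP n (ssp_depth m); first exact: start.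
case: n dn IH => // n; rewrite ltnS => dn IH.
have [stages ->] := sol n dn.
suff inv i : (i < nstages m)%N -> 0 <= tau n i /\ forall k a b, I k (w n i k a b).
  by apply: (inv _ _).2; rewrite prednK.
elim/ltn_ind: i => i ih ist; have [tauE wE] := stages i ist.
have [al1 ok] := val i ist.
pose p r :=
  [&& 0 < term_alpha r, 0 <= term_beta r & source_ok m i (term_source r)] &&
  ((0 < term_beta r) ==> (C_SSP m <= (term_alpha r / term_beta r)%:E)%E).
have pall : all p (stage_terms m i) by rewrite all_predI ok C_SSP_le.
have src r : p r ->
    0 <= source_value (fun q => q%:R * dt) (tau n) n (term_source r) /\
    forall k a b, I k (source_value u (w n) n (term_source r) k a b).
  move=> /andP[/and3P[_ _]]; case: (term_source r) => q /= qi _.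
    split; first by rewrite mulr_ge0 // ltW.
    by apply: IH; rewrite ltnS leq_subr.
  by apply: ih => //; exact: ltn_trans ist.
have step r : p r -> 0 <= term_beta r / term_alpha r * dt /\
    term_beta r / term_alpha r * dt * c <= kappa.
  move=> /andP[/and3P[a0 b0 _] /implyP bC].
  have ba0 : 0 <= term_beta r / term_alpha r by rewrite divr_ge0 // ltW.
  split; first by rewrite mulr_ge0 // ltW.
  have [->|bn0] := eqVneq (term_beta r) 0; first by rewrite !mul0r.
  have bp : 0 < term_beta r by rewrite lt_neqAle eq_sym bn0.
  have : dt * c <= term_alpha r / term_beta r * kappa.
    rewrite -lee_fin EFinM (le_trans cfl) // [in leRHS]EFinM.
    by rewrite lee_wpmul2r ?lee_fin // bC.
  move=> /(ler_wpM2l ba0); rewrite mulrA => /le_trans; apply.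
  by rewrite mulrA mulrA mulfVK ?mulfV ?mul1r // gt_eqF.
split.
  rewrite tauE; apply: (sumr_ge0_all pall) => r pr.
  have [a0 _] := andP (andP pr).1.
  by rewrite mulr_ge0 ?addr_ge0 ?(src r pr).1 ?(step r pr).1 // ltW.
move=> k a b; rewrite wE.
apply: (interval_convex_sum (FI k) pall al1) => r pr; split.
  by have [/ltW] := andP (andP pr).1.
have [[time_ge0 Isrc] [h_ge0 hc]] := (src r pr, step r pr).
exact: euler.
Qed.

End SSP.

(** * Cell averages of the initial datum *)

Lemma ae_lebesgue2_imply (R : realType) (P Q : R * R -> Prop) :
  {ae lebesgue2, forall x, P x} -> (forall x, P x -> Q x) ->
  {ae lebesgue2, forall x, Q x}.
Proof.
move=> aeP PQ; apply: filterS aeP => //.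
exact: (ae_filter_ringOfSetsType lebesgue2).
Qed.

Section Averages.
Context {R : realType} (dx1 dx2 : R).
Hypotheses (dx1_gt0 : 0 < dx1) (dx2_gt0 : 0 < dx2).

(** For [s = 1] a lower bound [b] of [g] passes to the average, for [s = -1] an
    upper bound. *)
Lemma cell_average_ae_ge0 (g : R * R -> R) (s b : R) i j :
  lebesgue2.-integrable (cell dx1 dx2 i j) (EFin \o g) ->
  {ae lebesgue2, forall x, 0 <= s * (g x - b)} ->
  0 <= s * (cell_average dx1 dx2 g i j - b).
Proof.
move=> ig gb; have mC := measurable_cell dx1 dx2 i j.
have A0 : 0 < dx1 * dx2 by rewrite mulr_gt0.
have ib : lebesgue2.-integrable (cell dx1 dx2 i j) (EFin \o cst b).
  apply: measurable_bounded_integrable => //.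
    by have := ltry (dx1 * dx2); rewrite -(lebesgue2_cell i j dx1_gt0 dx2_gt0).
  by exists `|b|; split => // M bM x _; exact: ltW.
have igb : lebesgue2.-integrable (cell dx1 dx2 i j) (EFin \o (fun x => g x - b)).
  have := integrableB mC ig ib.
  by congr (_.-integrable _ _); apply/funext => x /=; rewrite EFinB.
have isgb : lebesgue2.-integrable (cell dx1 dx2 i j)
    (EFin \o (fun x => s * (g x - b))).
  have := integrableZl mC s igb.
  by congr (_.-integrable _ _); apply/funext => x /=; rewrite EFinM.
have : 0 <= \int[lebesgue2]_(x in cell dx1 dx2 i j) (s * (g x - b)).
  (* Almost everywhere the integrand equals its absolute value. *)
  rewrite /Rintegral (@ae_eq_integral _ _ _ lebesgue2 _
    (EFin \o (fun x => `|s * (g x - b)|))) //.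
  - by apply: fine_ge0; apply: integral_ge0 => x _; rewrite lee_fin.
  - by case/integrableP : isgb.
  - by case/integrableP : (integrable_norm isgb).
  - by apply: (ae_lebesgue2_imply gb) => x gx _; rewrite /= ger0_norm.
rewrite RintegralZl // RintegralB // Rintegral_cst //.
rewrite -[X in fine X]/(lebesgue2 (cell dx1 dx2 i j)) lebesgue2_cell //=.
rewrite /cell_average.
set J := \int[lebesgue2]_(x in _) g x => h.
have -> : s * ((dx1 * dx2)^-1 * J - b) =
    (dx1 * dx2)^-1 * (s * (J - b * (dx1 * dx2))).
  by field; rewrite !gt_eqF.
by rewrite mulr_ge0 // invr_ge0 ltW.
Qed.

End Averages.

(** * The limited reconstruction and the theorem *)

Section LimitedReconstruction.
Context {R : realType} {K : nat} (dx1 dx2 : R).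
Hypotheses (dx1_gt0 : 0 < dx1) (dx2_gt0 : 0 < dx2).
Variables (I : 'I_K -> set R) (rec : state R K -> reconstruction R K).
Hypothesis rec_op : is_reconstruction_operator dx1 dx2 rec.
Variables (v : state R K).

Lemma limited_reconstruction_mem (Z : R -> Prop) k i j x :
  interval_with_endpoints Z (I k) -> I k (v k i j) ->
  closure (cell dx1 dx2 i j) x ->
  I k (limited_reconstruction dx1 dx2 I rec v k i j x).
Proof.
move=> FI Iv Cx; have [Pd _] := rec_op v k i j.
have [ub lb] := polynomial_bounded_cell dx1 dx2 i j Pd.
exact: (limiter_mem FI).
Qed.

(** The limited polynomial is an affine combination of the constant [v k i j] and
    of a quadratic polynomial with average [v k i j], so that it inherits this
    average whatever the scaling factor is. *)
Lemma limited_reconstruction_quadrature (s1 s2 : seq (R * R)) k i j :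
  exact_on_quadratics dx1 i%:~R s1 -> exact_on_quadratics dx2 j%:~R s2 ->
  v k i j = quadrature s1 (fun x => quadrature s2 (fun y =>
    limited_reconstruction dx1 dx2 I rec v k i j (x, y))).
Proof.
move=> ex1 ex2; have [Pd Pv] := rec_op v k i j.
have := cell_average_quadrature dx1_gt0 dx2_gt0 ex1 ex2 Pd; rewrite Pv.
set P := rec v k i j; set a := v k i j.
set th := limiter_theta (I k) (cell dx1 dx2 i j) a P.
move=> aE.
rewrite (@eq_quadrature _ s1 _
  (fun x => a * (1 - th) + th * quadrature s2 (fun y => P (x, y)))).
  by rewrite quadratureD (quadrature_cst _ _ ex1) ?gt_eqF // quadratureZ -aE; ring.
move=> x; rewrite (@eq_quadrature _ s2 _ (fun y => a * (1 - th) + th * P (x, y))).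
  by rewrite quadratureD (quadrature_cst _ _ ex2) ?gt_eqF // quadratureZ.
by move=> y; rewrite /limited_reconstruction -/P -/a -/th; ring.
Qed.

End LimitedReconstruction.

Unset Implicit Arguments.

Theorem theorem2p5 (R : realType) (K M : nat)
  (f : 'I_K -> R -> R * R -> R -> 'rV[R]_M -> R * R)
  (eta : 'I_M -> 'I_K -> R * R -> R)
  (rho0 : 'I_K -> R * R -> R)
  (I : 'I_K -> set R)
  (dx1 dx2 dt : R)
  (rec : state R K -> reconstruction R K)
  (F1 F2 : 'I_K -> R -> R -> R -> R * R -> 'rV[R]_M -> R)
  (L11 L12 L21 L22 : R)
  (meth : ssp_scheme R)
  (rho : nat -> state R K) (w : nat -> nat -> state R K)
  (tau : nat -> nat -> R)
  (hdx1 : 0 < dx1) (hdx2 : 0 < dx2) (hdt : 0 < dt)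
  (heta : forall m k, regular_kernel (eta m k))
  (hrho0 : forall k i j,
     lebesgue2.-integrable (cell dx1 dx2 i j) (EFin \o rho0 k))
  (hI : forall k, exists rho_m : R,
     [/\ 0 <= rho_m,
         forall t x r, 0 <= t -> f k t x rho_m r = (0, 0),
         {ae lebesgue2, forall x, rho_m <= rho0 k x} &
         I k = [set z | rho_m <= z] \/
         exists rho_M : R,
           [/\ forall t x r, 0 <= t -> f k t x rho_M r = (0, 0),
               {ae lebesgue2, forall x, rho0 k x <= rho_M} &
               I k = [set z | rho_m <= z <= rho_M]]])
  (hrec : is_reconstruction_operator dx1 dx2 rec)
  (hF1 : forall k, monotone_based_flux (I k)
     (fun t x u r => (f k t x u r).1) (F1 k) L11 L12)
  (hF2 : forall k, monotone_based_flux (I k)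
     (fun t x u r => (f k t x u r).2) (F2 k) L21 L22)
  (hmeth : ssp_valid meth)
  (hinit : forall k i j, rho 0%N k i j = cell_average dx1 dx2 (rho0 k) i j)
  (hstart : forall n, (0 < n <= ssp_depth meth)%N ->
     forall k i j, I k (rho n k i j))
  (hsol : ssp_solution meth dt
     (fun t v => semidiscrete_operator dx1 dx2 eta F1 F2
                    (limited_reconstruction dx1 dx2 I rec v) t) rho w tau)
  (hsum : forall n, nonlocal_well_defined dx1 dx2 eta
     (limited_reconstruction dx1 dx2 I rec (rho n)))
  (hsumw : forall n i, (ssp_depth meth <= n)%N -> (i < nstages meth)%N ->
     nonlocal_well_defined dx1 dx2 eta
       (limited_reconstruction dx1 dx2 I rec (w n i)))
  (hCFL : ((dt / dx1 * (L11 + L12) + dt / dx2 * (L21 + L22))%:E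
            <= C_SSP meth * (6^-1)%:E)%E) :
  forall (k : 'I_K) (i j : int) (n : nat), I k (rho n k i j).
Proof.
pose Z k b := forall t x r, 0 <= t -> f k t x b r = (0, 0).
have FI k : interval_with_endpoints (Z k) (I k).
  have [m [_ fm _ [->|[M' [fM _ ->]]]]] := hI k; exists m; split => //.
    by left.
  by right; exists M'.
move=> k i j n; move: n k i j.
apply: (ssp_invariant FI hmeth hdt
  (c := (L11 + L12) / dx1 + (L21 + L22) / dx2) (kappa := 6^-1) _ _ _ _ hsol) => //.
- move=> t h v t0 h0 cfl Iv k i j.
  apply: (mem_interval (FI k) (Iv k i j)) => s b Zb bar.
  apply: (euler_step hdx1 hdx2 _ (hF1 k) (hF2 k) bar t0 h0).
  + by move=> x r; rewrite Zb.
  + by move=> x r; rewrite Zb.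
  + by move=> i' j' x Cx; apply: (limited_reconstruction_mem hrec (FI k)).
  + apply: limited_reconstruction_quadrature => //.
      exact: simpson_exact.
    exact: gauss_exact.
  + apply: limited_reconstruction_quadrature => //.
      exact: gauss_exact.
    exact: simpson_exact.
  + by apply: le_trans cfl; rewrite le_eqVlt; apply/orP/or_introl/eqP; ring.
- rewrite (_ : dt * _ = dt / dx1 * (L11 + L12) + dt / dx2 * (L21 + L22)) //.
  ring.
- move=> [_|n nd]; last exact: hstart.
  move=> k i j; rewrite hinit.
  have [m [_ _ mrho [->|[M' [_ Mrho ->]]]]] := hI k => /=.
    rewrite -subr_ge0 -[_ - _]mul1r; apply: cell_average_ae_ge0 => //.
    by apply: (ae_lebesgue2_imply mrho) => x; rewrite mul1r subr_ge0.
  apply/andP; split.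
    rewrite -subr_ge0 -[_ - _]mul1r; apply: cell_average_ae_ge0 => //.
    by apply: (ae_lebesgue2_imply mrho) => x; rewrite mul1r subr_ge0.
  rewrite -subr_ge0 -opprB -mulN1r; apply: cell_average_ae_ge0 => //.
  by apply: (ae_lebesgue2_imply Mrho) => x; rewrite mulN1r opprB subr_ge0.
Qed.
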